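(* Let $(A\oplus A^*,\Theta=\psi+\gamma+\mu+\phi)$ be a pre-Courant algebroid, $(L=\Gamma(\wedge^\bullet A)[2],\,l=\mathcal M(\Theta))$ the corresponding curved pre-$L_\infty$-algebra, and $\pi\in\Gamma(\wedge^2A)=L_0$. Then $$\mathcal M(e^\pi\Theta)=\varepsilon^\pi(\mathcal M(\Theta))=\varepsilon^\pi l.$$
   Context: Big bracket. For a smooth vector bundle $A\to M$, let $\mathcal F=C^\infty(T^*[2]A[1])$ with the graded Poisson bracket $\{\cdot,\cdot\}$ (the big bracket) of the canonical symplectic structure of $T^*[2]A[1]$. In local coordinates $x_i,\xi_a$ on $A[1]$ and associated moment coordinates $p^i,\theta^a$ one has $\{p^i,x_i\}=\{\theta^a,\xi_a\}=1$ and all other brackets of coordinates vanish. The coordinates $x_i,\xi_a,p^i,\theta^a$ have bidegrees $(0,0),(0,1),(1,1),(1,0)$; $\mathcal F^{k,l}$ is the space of functions of bidegree $(k,l)$ and $\mathcal F^t=\bigoplus_{k+l=t}\mathcal F^{k,l}$. Then $\mathcal F^{k,0}=\Gamma(\wedge^kA)$, $\mathcal F^{0,l}=\Gamma(\wedge^lA^* )$. The bracket has bidegree $(-1,-1)$ and, with $|F|$ the total degree, satisfies $\{F,G\}=-(-1)^{|F||G|}\{G,F\}$, $\{F,GH\}=\{F,G\}H+(-1)^{|F||G|}G\{F,H\}$, $\{F,\{G,H\}\}=\{\{F,G\},H\}+(-1)^{|F||G|}\{G,\{F,H\}\}$; on $\Gamma(A\oplus A^* )$ it is the canonical pairing. Pre-Courant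 algebroids $(A\oplus A^*,\Theta)$ are identified with functions $\Theta\in\mathcal F^3$; $\Theta=\psi+\gamma+\mu+\phi$ with $\psi\in\mathcal F^{3,0}$, $\gamma\in\mathcal F^{2,1}$, $\mu\in\mathcal F^{1,2}$, $\phi\in\mathcal F^{0,3}$. The twisting of $\Theta$ by $\pi\in\Gamma(\wedge^2A)$ is $e^\pi\Theta=\Theta+\{\pi,\Theta\}+\frac1{2!}\{\pi,\{\pi,\Theta\}\}+\frac1{3!}\{\pi,\{\pi,\{\pi,\Theta\}\}\}+\cdots\in\mathcal F^3$ (a finite sum for bidegree reasons). $L=\bigoplus_{i\ge-2}L_i$ with $L_i=\Gamma(\wedge^{i+2}A)$. The map $\mathcal M$ sends $\Theta=\psi+\gamma+\mu+\phi$ to $l=l_0+l_1+l_2+l_3$, graded symmetric brackets of degree $1$ on $L$ given by $l_0=\psi$, $l_1(P)=\{\gamma,P\}$, $l_2(P,Q)=\{\{\mu,P\},Q\}$, $l_3(P,Q,R)=\{\{\{\phi,P\},Q\},R\}$. For $\pi\in L_0$, the twisting $\varepsilon^\pi l=\sum_{i=0}^3(\varepsilon^\pi l)_i$ is given by $(\varepsilon^\pi l)_0=l_0-l_1(\pi)+\frac12l_2(\pi,\pi)-\frac16l_3(\pi,\pi,\pi)$, $(\varepsilon^\pi l)_1=l_1-l_2(\pi,\cdot)+\frac12l_3(\pi,\pi,\cdot)$, $(\varepsilon^\pi l)_2=l_2-l_3(\pi,\cdot,\cdot)$, $(\varepsilon^\pi l)_3=l_3$. *)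

(* Defs.v *)
(* MathComp and MathComp-Analysis. *)
From HB Require Import structures.
From mathcomp Require Export all_boot all_order all_algebra.
From mathcomp Require Export all_classical all_reals all_analysis.

Set Implicit Arguments.
Unset Strict Implicit.
Unset Printing Implicit Defensive.

Import Order.TTheory GRing.Theory Num.Theory.
Import numFieldNormedType.Exports.

Local Open Scope ring_scope.

(** * Smooth manifolds and vector bundles *)

Section smooth_functions.
Local Open Scope classical_set_scope.
Variables (R : realType) (n : nat).

Definition partial (i : 'I_n) (f : 'rV[R]_n -> R) : 'rV[R]_n -> R :=
  fun x => 'D_(delta_mx 0 i) f x.

(* For an open W this says exactly that f is of class C^oo on W: all iterated
   partial derivatives exist and are differentiable, hence continuous. *)
Definition smooth_on (W : set 'rV[R]_n) (f : 'rV[R]_n -> R) : Prop :=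
  forall (s : seq 'I_n) (x : 'rV[R]_n),
    W x -> differentiable (foldr partial f s) x.

End smooth_functions.

Section manifolds.
Local Open Scope classical_set_scope.

Record manifold (R : realType) (n : nat) := Manifold {
  man_space :> topologicalType;
  man_hausdorff : hausdorff_space man_space;
  man_second_countable : @second_countable man_space;
  chart : Type;
  cdom : chart -> set man_space;
  coord : chart -> man_space -> 'rV[R]_n;
  uncoord : chart -> 'rV[R]_n -> man_space;
  cdom_open : forall i, open (cdom i);
  cdom_cover : forall z, exists i, cdom i z;
  coord_open : forall i, open (coord i @` cdom i);
  coordK : forall i z, cdom i z -> uncoord i (coord i z) = z;
  coord_continuous : forall i, {within cdom i, continuous (coord i)};
  uncoord_continuous :
    forall i, {within coord i @` cdom i, continuous (uncoord i)};
  coord_smooth : forall i j b,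
    smooth_on (coord i @` (cdom i `&` cdom j))
              (fun x => coord j (uncoord i x) 0 b) }.

(* A rank r bundle, as a family of vector spaces with local trivialisations;
   the total space carries the unique smooth structure for which they are
   smooth.  trans_mx f j j' z is the matrix of the change of trivialisation, acting
   on row vectors. *)
Definition trans_mx (R : realType) (r : nat) (T J : Type)
    (fib : T -> lmodType R) (triv : J -> forall z, fib z -> 'rV[R]_r)
    (untriv : J -> forall z, 'rV[R]_r -> fib z) (j j' : J) (z : T) : 'M[R]_r :=
  \matrix_(a, b) triv j' z (untriv j z (delta_mx 0 a)) 0 b.

Record vbundle (R : realType) (n r : nat) (M : manifold R n) := VBundle {
  fiber : M -> lmodType R;
  tindex : Type;
  tdom : tindex -> set M;
  triv : tindex -> forall z, fiber z -> 'rV[R]_r;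
  untriv : tindex -> forall z, 'rV[R]_r -> fiber z;
  tdom_open : forall j, open (tdom j);
  tdom_cover : forall z, exists j, tdom j z;
  triv_linear : forall j z, tdom j z -> linear (@triv j z);
  trivK : forall j z, tdom j z -> cancel (@triv j z) (@untriv j z);
  untrivK : forall j z, tdom j z -> cancel (@untriv j z) (@triv j z);
  triv_smooth : forall (i : chart M) (j j' : tindex) (a b : 'I_r),
    smooth_on (coord i @` (cdom i `&` (tdom j `&` tdom j')))
              (fun x => trans_mx (@triv) (@untriv) j j' (uncoord i x) a b) }.

End manifolds.

(** * Functions on T^*[2]A[1] in one coordinate system *)

Section coordinate_algebra.
Variables (R : realType) (n r : nat).

(* Odd generators: xi_a is indexed by lshift r a and theta^a by rshift r a. *)
Definition xi_ix (a : 'I_r) : 'I_(r + r) := lshift r a.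
Definition th_ix (a : 'I_r) : 'I_(r + r) := rshift r a.

Definition mindex := {ffun 'I_n -> nat}.

(* u m S is the coefficient of p^m times the product of the odd generators with
   index in S, taken in increasing order (so the xi's come before the theta's).
   No finiteness is imposed on the exponents m of the even generators p; the
   homogeneous elements are polynomial in p. *)
Definition coefs := mindex -> {set 'I_(r + r)} -> R.

Definition mdeg (m : mindex) : nat := (\sum_(i < n) m i)%N.
Definition bideg1 (m : mindex) (S : {set 'I_(r + r)}) : nat :=
  (mdeg m + #|[set a : 'I_r | th_ix a \in S]|)%N.
Definition bideg2 (m : mindex) (S : {set 'I_(r + r)}) : nat :=
  (mdeg m + #|[set a : 'I_r | xi_ix a \in S]|)%N.

(* The sign of the shuffle that sorts the concatenation of S and T. *)
Definition ksign (S T : {set 'I_(r + r)}) : R :=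
  (-1) ^+ #|[set st : 'I_(r + r) * 'I_(r + r)
              | [&& st.1 \in S, st.2 \in T & (st.2 < st.1)%N]]|.

Definition cmul (u v : coefs) : coefs := fun m S =>
  \sum_(k : {dffun forall i : 'I_n, 'I_(m i).+1})
   \sum_(T in powerset S)
     ksign T (S :\: T) * u [ffun i => k i : nat] T
                       * v [ffun i => (m i - k i)%N] (S :\: T).

Definition cone : coefs := fun m S =>
  ((m == [ffun=> 0%N]) && (S == finset.set0))%:R.
Definition codd (a : 'I_(r + r)) : coefs :=
  fun m S => ((m == [ffun=> 0%N]) && (S == [set a]))%:R.
Definition ceven (i : 'I_n) : coefs :=
  fun m S => ((m == [ffun j => (j == i) : nat]) && (S == finset.set0))%:R.

Definition deriv_p (i : 'I_n) (u : coefs) : coefs := fun m S =>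
  u [ffun j => (m j + (j == i))%N] S *+ (m i).+1.
Definition lderiv (a : 'I_(r + r)) (u : coefs) : coefs := fun m S =>
  if a \in S then 0 else ksign [set a] S * u m (a |: S).
Definition rderiv (a : 'I_(r + r)) (u : coefs) : coefs := fun m S =>
  if a \in S then 0 else ksign S [set a] * u m (a |: S).
Definition deriv_x (i : 'I_n) (f : 'rV[R]_n -> coefs) (x : 'rV[R]_n) : coefs :=
  fun m S => partial i (fun y => f y m S) x.

(* The Poisson bracket with {p^i,x_i} = {theta^a,xi_a} = 1; writing the first
   argument with right derivatives absorbs all signs. *)
Definition cbracket (f g : 'rV[R]_n -> coefs) (x : 'rV[R]_n) : coefs :=
    \sum_(i < n) (cmul (deriv_p i (f x)) (deriv_x i g x)
                - cmul (deriv_x i f x) (deriv_p i (g x)))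
  + \sum_(a < r) (cmul (rderiv (th_ix a) (f x)) (lderiv (xi_ix a) (g x))
                + cmul (rderiv (xi_ix a) (f x)) (lderiv (th_ix a) (g x))).

End coordinate_algebra.

Section bidegree.
Variables (R : realType) (n r : nat).
Implicit Types (P Q : nat -> nat -> Prop) (u v : coefs R n r)
  (f : 'I_r -> 'I_(r + r)).

Lemma card_odd f (T S : {set 'I_(r + r)}) : T \subset S ->
  (#|[set a | f a \in T]| + #|[set a | f a \in S :\: T]|)%N
    = #|[set a | f a \in S]|.
Proof.
move=> TS; rewrite -[RHS](cardsID [set a | f a \in T]); congr (_ + _)%N.
  apply: eq_card => a; rewrite !inE.
  by case fT: (f a \in T); rewrite ?andbT ?andbF // (fintype.subsetP TS).
by apply: eq_card => a; rewrite !inE.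
Qed.

Lemma card_oddU1 f a (S : {set 'I_(r + r)}) : injective f -> f a \notin S ->
  #|[set b | f b \in f a |: S]| = #|[set b | f b \in S]|.+1.
Proof.
move=> finj aS; rewrite -(card_odd f (finset.subsetUl [set f a] S)) -add1n.
congr (_ + _)%N.
  by rewrite -(cards1 a); apply: eq_card => b; rewrite !inE (inj_eq finj).
apply: eq_card => b; rewrite !inE.
by case: eqP => [->|//]; rewrite (negPf aS).
Qed.

Lemma card_oddU1_id f s (S : {set 'I_(r + r)}) : (forall b, f b != s) ->
  #|[set b | f b \in s |: S]| = #|[set b | f b \in S]|.
Proof.
by move=> fs; apply: eq_card => b; rewrite !inE (negPf (fs b)).
Qed.

Lemma bidegU1_xi a m (S : {set 'I_(r + r)}) : xi_ix a \notin S ->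
  bideg1 m (xi_ix a |: S) = bideg1 (n := n) m S /\
  bideg2 m (xi_ix a |: S) = (bideg2 m S).+1.
Proof.
move=> aS; rewrite /bideg1 /bideg2 (card_oddU1 (@lshift_inj r r)) // addnS.
by rewrite card_oddU1_id // => b; rewrite eq_rlshift.
Qed.

Lemma bidegU1_th a m (S : {set 'I_(r + r)}) : th_ix a \notin S ->
  bideg1 m (th_ix a |: S) = (bideg1 (n := n) m S).+1 /\
  bideg2 m (th_ix a |: S) = bideg2 m S.
Proof.
move=> aS; rewrite /bideg1 /bideg2 (card_oddU1 (@rshift_inj r r)) // addnS.
by rewrite card_oddU1_id // => b; rewrite eq_lrshift.
Qed.

Definition cbideg_in P u : Prop :=
  forall m S, u m S != 0 -> P (bideg1 m S) (bideg2 m S).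

Lemma cmul_bideg P Q u v : cbideg_in P u -> cbideg_in Q v ->
  forall m S, cmul u v m S != 0 -> exists k l k' l',
    [/\ P k l, Q k' l', bideg1 m S = (k + k')%N & bideg2 m S = (l + l')%N].
Proof.
move=> hu hv m S; apply: contra_neqP => nE; rewrite /cmul.
apply: big1 => k _; apply: big1 => T; rewrite powersetE => TS.
have [u0|/hu Pk] := eqVneq (u [ffun i => k i : nat] T) 0.
  by rewrite u0 mulr0 mul0r.
have [v0|/hv Qk] := eqVneq (v [ffun i => (m i - k i)%N] (S :\: T)) 0.
  by rewrite v0 mulr0.
have mdegD : mdeg m = (mdeg [ffun i => k i : nat] +
                       mdeg [ffun i => (m i - k i)%N])%N.
  rewrite /mdeg -big_split; apply: eq_bigr => i _ /=.
  by rewrite !ffunE subnKC // -ltnS.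
exfalso; apply: nE; do 4 eexists; split; [exact: Pk|exact: Qk| |].
- by rewrite /bideg1 -(card_odd (@th_ix r) TS) mdegD addnACA.
- by rewrite /bideg2 -(card_odd (@xi_ix r) TS) mdegD addnACA.
Qed.

Lemma deriv_p_bideg P i u : cbideg_in P u ->
  cbideg_in (fun k l => P k.+1 l.+1) (deriv_p i u).
Proof.
move=> hu m S; rewrite /deriv_p mulrn_eq0 negb_or => /andP[_ /hu].
suff mdegS : mdeg [ffun j => (m j + (j == i))%N] = (mdeg m).+1.
  by rewrite /bideg1 /bideg2 mdegS !addSn.
rewrite /mdeg (bigD1 i) //= [in RHS](bigD1 i) //= ffunE eqxx addn1 addSn.
by congr (_ + _).+1; apply: eq_bigr => j /negPf ji; rewrite ffunE ji addn0.
Qed.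

Lemma lderiv_neq0 s u m S : lderiv s u m S != 0 ->
  s \notin S /\ u m (s |: S) != 0.
Proof.
by rewrite /lderiv; case: ifP; rewrite ?eqxx // mulf_eq0 negb_or => _ /andP[].
Qed.

Lemma rderiv_neq0 s u m S : rderiv s u m S != 0 ->
  s \notin S /\ u m (s |: S) != 0.
Proof.
by rewrite /rderiv; case: ifP; rewrite ?eqxx // mulf_eq0 negb_or => _ /andP[].
Qed.

Lemma deriv_x_bideg P i (f : 'rV[R]_n -> coefs R n r) x :
  (forall y, cbideg_in P (f y)) -> cbideg_in P (deriv_x i f x).
Proof.
move=> hf m S; apply: contra_neqP => nP; rewrite /deriv_x /partial.
suff -> : (fun y => f y m S) = cst 0 by rewrite derive_cst.
by apply/funext => y; have [//|/hf] := eqVneq (f y m S) 0.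
Qed.

Lemma lderiv_xi_bideg P a u : cbideg_in P u ->
  cbideg_in (fun k l => P k l.+1) (lderiv (xi_ix a) u).
Proof.
by move=> hu m S /lderiv_neq0[aS /hu]; have [-> ->] := bidegU1_xi m aS.
Qed.

Lemma lderiv_th_bideg P a u : cbideg_in P u ->
  cbideg_in (fun k l => P k.+1 l) (lderiv (th_ix a) u).
Proof.
by move=> hu m S /lderiv_neq0[aS /hu]; have [-> ->] := bidegU1_th m aS.
Qed.

Lemma rderiv_xi_bideg P a u : cbideg_in P u ->
  cbideg_in (fun k l => P k l.+1) (rderiv (xi_ix a) u).
Proof.
by move=> hu m S /rderiv_neq0[aS /hu]; have [-> ->] := bidegU1_xi m aS.
Qed.

Lemma rderiv_th_bideg P a u : cbideg_in P u ->
  cbideg_in (fun k l => P k.+1 l) (rderiv (th_ix a) u).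
Proof.
by move=> hu m S /rderiv_neq0[aS /hu]; have [-> ->] := bidegU1_th m aS.
Qed.

(* The bracket has bidegree (-1,-1). *)
Lemma cbracket_bideg P Q (f g : 'rV[R]_n -> coefs R n r) x :
  (forall y, cbideg_in P (f y)) -> (forall y, cbideg_in Q (g y)) ->
  forall m S, cbracket f g x m S != 0 -> exists k l k' l',
    [/\ P k l, Q k' l', (bideg1 m S).+1 = (k + k')%N
      & (bideg2 m S).+1 = (l + l')%N].
Proof.
move=> hf hg m S; apply: contra_neqP => nE.
have fx i : cbideg_in P (deriv_x i f x) by exact: deriv_x_bideg.
have gx i : cbideg_in Q (deriv_x i g x) by exact: deriv_x_bideg.
have cmul0 (P' Q' : nat -> nat -> Prop) u v :
    cbideg_in P' u -> cbideg_in Q' v ->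
    (forall k l k' l', P' k l -> Q' k' l' -> exists k1 l1 k2 l2,
       [/\ P k1 l1, Q k2 l2, (k + k').+1 = (k1 + k2)%N
         & (l + l').+1 = (l1 + l2)%N]) ->
    cmul u v m S = 0.
  move=> hu hv PQ; have [//|/(cmul_bideg hu hv)] := eqVneq (cmul u v m S) 0.
  move=> [k [l [k' [l' [Pk Qk e1 e2]]]]]; exfalso; apply: nE.
  by rewrite e1 e2; exact: PQ Pk Qk.
rewrite /cbracket; rewrite [LHS](_ : _ =
    \sum_(i < n) (cmul (deriv_p i (f x)) (deriv_x i g x) m S
                - cmul (deriv_x i f x) (deriv_p i (g x)) m S)
  + \sum_(a < r) (cmul (rderiv (th_ix a) (f x)) (lderiv (xi_ix a) (g x)) m S
                + cmul (rderiv (xi_ix a) (f x)) (lderiv (th_ix a) (g x)) m S)).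
  rewrite !big1 ?addr0 // => i _.
    rewrite (cmul0 _ _ _ _ (rderiv_th_bideg (a:=i) (hf x)) (lderiv_xi_bideg (a:=i) (hg x))).
      rewrite (cmul0 _ _ _ _ (rderiv_xi_bideg (a:=i) (hf x)) (lderiv_th_bideg (a:=i) (hg x))).
        by rewrite addr0.
      by move=> k l k' l' Pk Qk; exists k, l.+1, k'.+1, l'; split; rewrite ?addnS.
    by move=> k l k' l' Pk Qk; exists k.+1, l, k', l'.+1; split; rewrite ?addnS.
  rewrite (cmul0 _ _ _ _ (deriv_p_bideg (i:=i) (hf x)) (gx i)).
    rewrite (cmul0 _ _ _ _ (fx i) (deriv_p_bideg (i:=i) (hg x))) ?subr0 //.
    by move=> k l k' l' Pk Qk; exists k, l, k'.+1, l'.+1; split; rewrite ?addnS.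
  by move=> k l k' l' Pk Qk; exists k.+1, l.+1, k', l'; split; rewrite ?addnS.
by rewrite -[LHS]/(_ m S + _ m S) !fct_sumE.
Qed.
End bidegree.

(** * Global functions and the big bracket *)

Section big_bracket.
Variables (R : realType) (n r : nat) (M : manifold R n) (A : vbundle r M).

Definition csys : Type := (chart M * tindex A)%type.

Definition cpatch (c : csys) : set 'rV[R]_n :=
  (coord c.1 @` (cdom c.1 `&` tdom c.2))%classic.
Definition coverlap (c c' : csys) : set 'rV[R]_n :=
  (coord c.1 @` ((cdom c.1 `&` tdom c.2) `&` (cdom c'.1 `&` tdom c'.2)))%classic.

Definition base_change (c c' : csys) (x : 'rV[R]_n) : 'rV[R]_n :=
  coord c'.1 (uncoord c.1 x).
Definition fiber_change (c c' : csys) (x : 'rV[R]_n) : 'M[R]_r :=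
  trans_mx (@triv _ _ _ _ A) (@untriv _ _ _ _ A) c.2 c'.2 (uncoord c.1 x).

(* The coordinates of c' at x' = base_change c c' x written in those of c.
   Let G, H be the fibre changes from c to c' and back.  The xi's are the
   linear fibre coordinates and the theta's the dual frame, so that
     xi'_a = sum_b G_ba xi_b,        theta'^a = sum_b H_ab theta^b,
   and invariance of the canonical one-form p^i dx_i + theta^a dxi_a gives
     p'^j = sum_i (dx_i/dx'_j) p^i + sum_(a,b) (dH_ba/dx'_j) xi'_b theta^a. *)
Definition xi_change (c c' : csys) (x : 'rV[R]_n) (a : 'I_r) : coefs R n r :=
  \sum_(b < r) fiber_change c c' x b a *: @codd R n r (xi_ix b).
Definition th_change (c c' : csys) (x : 'rV[R]_n) (a : 'I_r) : coefs R n r :=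
  \sum_(b < r) fiber_change c' c (base_change c c' x) a b
                 *: @codd R n r (th_ix b).
Definition p_change (c c' : csys) (x : 'rV[R]_n) (j : 'I_n) : coefs R n r :=
    \sum_(i < n) partial j (fun y => base_change c' c y 0 i) (base_change c c' x)
                   *: @ceven R n r i
  + \sum_(a < r) \sum_(b < r)
      partial j (fun y => fiber_change c' c y b a) (base_change c c' x)
        *: cmul (xi_change c c' x b) (@codd R n r (th_ix a)).

Definition odd_change (c c' : csys) (x : 'rV[R]_n) (s : 'I_(r + r)) :
    coefs R n r :=
  match fintype.split s with
  | inl a => xi_change c c' x a
  | inr a => th_change c c' x a
  end.

Definition monomial_change (c c' : csys) (x : 'rV[R]_n)
    (m : mindex n) (S : {set 'I_(r + r)}) : coefs R n r :=
  cmul (\big[@cmul R n r/@cone R n r]_(j < n)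
          iter (m j) (cmul (p_change c c' x j)) (@cone R n r))
       (\big[@cmul R n r/@cone R n r]_(s <- enum S) odd_change c c' x s).

(* The change of coordinates preserves the total degree 2|m| + #|S|, so only
   the exponents k with all k_i <= 2|m| + #|S| can contribute below. *)
Definition pullback (c c' : csys) (x : 'rV[R]_n) (u : coefs R n r) :
    coefs R n r := fun m S =>
  \sum_(k : {ffun 'I_n -> 'I_((mdeg m).*2 + #|S|).+1})
   \sum_(T : {set 'I_(r + r)})
     u [ffun i => k i : nat] T
       * monomial_change c c' x [ffun i => k i : nat] T m S.

(* Families of coordinate expressions, not yet required to glue. *)
Definition family : Type := csys -> 'rV[R]_n -> coefs R n r.

(* A function on T^*[2]A[1].  Coordinate expressions only matter on the patch
   of their coordinate system; they are extended by 0 so that equality of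
   functions is the equality of families. *)
Definition is_function (F : family) : Prop :=
  [/\ forall c m S, smooth_on (cpatch c) (fun x => F c x m S),
      forall c x, ~ cpatch c x -> F c x = 0
    & forall c c' x, coverlap c c' x ->
        F c x = pullback c c' x (F c' (base_change c c' x))].

(* All bidegrees (k,l) occurring in F satisfy P. *)
Definition bideg_in (P : nat -> nat -> Prop) (F : family) : Prop :=
  forall c x m S, F c x m S != 0 -> P (bideg1 m S) (bideg2 m S).

(* The space F^{k,l}; in particular F^{k,0} is the space of sections of
   /\^k A. *)
Definition Fbi (k l : nat) (F : family) : Prop :=
  is_function F /\ bideg_in (fun k' l' => k' = k /\ l' = l) F.
Definition Ftot (t : nat) (F : family) : Prop :=
  is_function F /\ bideg_in (fun k l => (k + l)%N = t) F.

Definition component (k l : nat) (F : family) : family := fun c x m S =>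
  if (bideg1 m S == k) && (bideg2 m S == l) then F c x m S else 0.

Definition bracket (F G : family) : family := fun c x =>
  if x \in cpatch c then cbracket (F c) (G c) x else 0.

Lemma bracket_bideg P Q (F G : family) : bideg_in P F -> bideg_in Q G ->
  bideg_in (fun K L => exists k l k' l',
    [/\ P k l, Q k' l', K.+1 = (k + k')%N & L.+1 = (l + l')%N]) (bracket F G).
Proof.
move=> hF hG c x m S; rewrite /bracket; case: ifP => _; last by rewrite eqxx.
by apply: cbracket_bideg => y m' S'; [exact: hF|exact: hG].
Qed.

Lemma twist_terms_eq0 (pi Theta : family) (i : nat) :
  Fbi 2 0 pi -> Ftot 3 Theta -> (4 <= i)%N -> iter i (bracket pi) Theta = 0.
Proof.
move=> [_ hpi] [_ hTheta] i4.
have h j : bideg_in (fun k l => (k + l)%N = 3 /\ (j <= k)%N)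
                    (iter j (bracket pi) Theta).
  elim: j => [|j IH] c x m S; first by move=> /hTheta.
  move=> /(bracket_bideg hpi IH)[k [l [k' [l' [[-> ->] [e jk] e1 e2]]]]].
  by move: e1 e2; rewrite addSn add1n add0n => -[->] e2; rewrite -e -e2 addnS.
apply/funext => c; apply/funext => x; apply/funext => m; apply/funext => S.
apply/eqP/negPn/negP => /h[e ik].
by have := leq_trans i4 (leq_trans ik (leq_addr (bideg2 m S) _)); rewrite e.
Qed.

(* Truncating the exponential series after the cubic term loses nothing,
   see twist_terms_eq0. *)
Definition twist (pi Theta : family) : family :=
  \sum_(i < 4) (i`!%:R : R)^-1 *: iter i (bracket pi) Theta.

(** * Brackets on L = Gamma(/\A)[2] *)

(* The degree i part L_i consists of the elements of Fbi i.+2 0. *)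
Record polyvec := Polyvec {
  pv_family :> family;
  pv_function : is_function pv_family;
  pv_bideg : bideg_in (fun k l => l = 0%N) pv_family }.

(* For brackets of elements of Ftot and polyvec the values below are again
   multivector fields, because the big bracket does not depend on coordinates;
   this is not built into the types. *)
Record brackets := Brackets {
  l0 : family;
  l1 : polyvec -> family;
  l2 : polyvec -> polyvec -> family;
  l3 : polyvec -> polyvec -> polyvec -> family }.

Definition brackets_of (Theta : family) : brackets :=
  let psi := component 3 0 Theta in
  let gamma := component 2 1 Theta in
  let mu := component 1 2 Theta in
  let phi := component 0 3 Theta in
  {| l0 := psi;
     l1 := fun P => bracket gamma P;
     l2 := fun P Q => bracket (bracket mu P) Q;
     l3 := fun P Q S => bracket (bracket (bracket phi P) Q) S |}.

Definition btwist (pi : polyvec) (l : brackets) : brackets :=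
  {| l0 := l0 l - l1 l pi + (2%:R : R)^-1 *: l2 l pi pi
             - (6%:R : R)^-1 *: l3 l pi pi pi;
     l1 := fun P => l1 l P - l2 l pi P + (2%:R : R)^-1 *: l3 l pi pi P;
     l2 := fun P Q => l2 l P Q - l3 l pi P Q;
     l3 := l3 l |}.

End big_bracket.

(* Main.v *)
Require Import Defs.
Set Implicit Arguments.
Unset Strict Implicit.
Unset Printing Implicit Defensive.
Import Order.TTheory GRing.Theory Num.Theory.
Import numFieldNormedType.Exports.
Local Open Scope ring_scope.

(** Write D for the operator F |-> {F, pi}.  Since pi has even total degree,
    antisymmetry of the big bracket reads {pi, F} = - {F, pi}
    ([bracket_antisym]), so that
      e^pi Theta = Theta - D Theta + 1/2 D^2 Theta - 1/6 D^3 Theta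
    ([twistE]).  As pi has bidegree (2,0) and the bracket has bidegree (-1,-1),
    D raises the first degree by one and lowers the second by one
    ([component_bracket], [component0_bracket]).  Hence the components of
    e^pi Theta are
      psi - D gamma + 1/2 D^2 mu - 1/6 D^3 phi,
      gamma - D mu + 1/2 D^2 phi,      mu - D phi,      phi.
    Bracketing the second once and the third twice with multivector fields, and
    expanding by linearity in the first argument ([bracket_linearl]), gives
    the twisted brackets term by term: D^i phi is phi with pi inserted i
    times as its first entries, which is how pi enters the twisted brackets.  

    All this is checked in one coordinate system at a time.  Antisymmetry is
    graded commutativity of the product ([cmul_swap]) together with the
    comparison of left and right odd derivatives ([rderivE]).  Linearity of the
    bracket needs derivatives of sums, hence differentiable coefficients, also
    for the iterated brackets D^i Theta; therefore one has to know that brackets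
    of smooth families are again smooth on each coordinate patch
    ([smooth_family_bracket]), which rests on smooth functions on an open set
    being closed under sums, products and partial derivatives. *)

(** * Smooth functions on an open set *)

Section smooth_calculus.
Local Open Scope classical_set_scope.

(** The differential is a choice of linear map, so locality is not immediate: the
    expansion of f at x is transported to g, and uniqueness of the differential
    then identifies the chosen maps. *)
Lemma near_eq_differentiable (R : numFieldType) (V V' : normedModType R)
    (f g : V -> V') (x : V) :
  (\near x, f x = g x) -> differentiable f x -> differentiable g x.
Proof.
move=> fg /diff_locallyP[cdf /eqaddoE df].
have dg : g \o shift x = cst (g x) + 'd f x +o_ 0 id.
  apply/eqaddoP => e e0.
  have /eqaddoP/(_ e e0) := diff_locally (proj2 (diff_locallyP x f) (conj cdf df)).
  have fg0 : \forall h \near (0 : V), f (h + x) = g (h + x).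
    have : \forall h \near x, f h = g h by [].
    by rewrite (near_shift 0 x) /= subr0.
  apply: filterS2 fg0 => h /= fgh.
  by rewrite !fctE /= fgh (nbhs_singleton fg).
by apply/diff_locallyP; rewrite (diff_unique cdf dg).
Qed.

Variables (R : realType) (n : nat) (W : set 'rV[R]_n).
Hypothesis oW : open W.
Implicit Types f g : 'rV[R]_n -> R.

(** Smoothness up to a finite order: unlike smoothness, it can be shown to be
    stable under products by induction, the Leibniz rule lowering the order. *)
Fixpoint diffn (k : nat) f : Prop :=
  (forall x, W x -> differentiable f x) /\
  if k is k'.+1 then forall i, diffn k' (partial i f) else True.

Lemma smooth_diffn f : smooth_on W f <-> forall k, diffn k f.
Proof.
split=> [sf k|df s].
  elim: k f sf => [|k IH] f sf /=; first by split=> // x; exact: (sf [::]).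
  split=> [x|i]; first exact: (sf [::]).
  by apply: IH => s x Wx; have := sf (rcons s i) x Wx; rewrite foldr_rcons.
elim/last_ind: s f df => [|s i IH] f df x Wx; first exact: (df 0).1.
by rewrite foldr_rcons; apply: IH => // k; exact: (df k.+1).2.
Qed.

Lemma diffnW k f : diffn k.+1 f -> diffn k f.
Proof.
elim: k f => [|k IH] f [df dpf]; split=> // i.
by apply: IH; exact: dpf.
Qed.

(** Openness of W turns agreement on W into agreement near each of its points,
    which is what derivatives depend on. *)
Lemma eq_near x f g : W x -> {in W, f =1 g} -> \near x, f x = g x.
Proof.
move=> Wx fg; apply: filterS (open_nbhs_nbhs (conj oW Wx)) => y Wy.
by apply: fg; rewrite inE.
Qed.

Lemma eq_partial i f g : {in W, f =1 g} -> {in W, partial i f =1 partial i g}.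
Proof.
by move=> fg x /set_mem Wx; apply: near_eq_derive; exact: eq_near.
Qed.

Lemma eq_diffn k f g : {in W, f =1 g} -> diffn k f -> diffn k g.
Proof.
elim: k f g => [|k IH] f g fg /= [df dpf]; split=> //.
- by move=> x Wx; apply: near_eq_differentiable (df x Wx); exact: eq_near.
- by move=> x Wx; apply: near_eq_differentiable (df x Wx); exact: eq_near.
- by move=> i; apply: IH (dpf i); exact: eq_partial.
Qed.

Lemma diffnD k f g : diffn k f -> diffn k g -> diffn k (f + g).
Proof.
elim: k f g => [|k IH] f g [df dpf] [dg dpg]; split=> //.
- by move=> x Wx; apply: differentiableD; [exact: df|exact: dg].
- by move=> x Wx; apply: differentiableD; [exact: df|exact: dg].
move=> i; apply: eq_diffn (IH _ _ (dpf i) (dpg i)) => x /set_mem Wx.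
by rewrite /partial deriveD //; apply: diff_derivable; [exact: df|exact: dg].
Qed.

Lemma diffnM k f g : diffn k f -> diffn k g -> diffn k (f * g).
Proof.
elim: k f g => [|k IH] f g df dg; split=> //.
- by move=> x Wx; apply: differentiableM; [exact: df.1|exact: dg.1].
- by move=> x Wx; apply: differentiableM; [exact: df.1|exact: dg.1].
move=> i; apply: (@eq_diffn _ (f * partial i g + g * partial i f)).
  move=> x /set_mem Wx; rewrite /partial deriveM //.
    by apply: diff_derivable; exact: df.1.
  by apply: diff_derivable; exact: dg.1.
apply: diffnD; apply: IH.
- exact: diffnW.
- exact: dg.2.
- exact: diffnW.
- exact: df.2.
Qed.

Lemma diffn_cst k (a : R) : diffn k (cst a).
Proof.
elim: k a => [|k IH] a; split=> //.
by move=> i; apply: eq_diffn (IH 0) => x _; rewrite /partial derive_cst.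
Qed.

Lemma eq_smooth f g : {in W, f =1 g} -> smooth_on W f -> smooth_on W g.
Proof.
by move=> fg /smooth_diffn sf; apply/smooth_diffn => k; exact: eq_diffn (sf k).
Qed.

Lemma smoothD f g : smooth_on W f -> smooth_on W g -> smooth_on W (f + g).
Proof.
by move=> /smooth_diffn sf /smooth_diffn sg; apply/smooth_diffn => k; apply: diffnD.
Qed.

Lemma smoothM f g : smooth_on W f -> smooth_on W g -> smooth_on W (f * g).
Proof.
by move=> /smooth_diffn sf /smooth_diffn sg; apply/smooth_diffn => k; apply: diffnM.
Qed.

Lemma smooth_cst a : smooth_on W (cst a).
Proof. by apply/smooth_diffn => k; exact: diffn_cst. Qed.

Lemma smooth_partial i f : smooth_on W f -> smooth_on W (partial i f).
Proof.
by move=> sf s x Wx; have := sf (rcons s i) x Wx; rewrite foldr_rcons.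
Qed.

Lemma smooth_sum (I : Type) (s : seq I) (P : pred I) (F : I -> 'rV[R]_n -> R) :
  (forall i, P i -> smooth_on W (F i)) ->
  smooth_on W (fun x => \sum_(i <- s | P i) F i x).
Proof.
move=> sF; rewrite (_ : (fun x => _) = \sum_(i <- s | P i) F i).
  by elim/big_ind : _ => // [|f g]; [exact: (smooth_cst 0)|exact: smoothD].
by apply/funext => x; rewrite fct_sumE.
Qed.

End smooth_calculus.

(** * The bracket in one coordinate system *)

Section coordinate_bracket.
Variables (R : realType) (n r : nat).
Implicit Types (u v : coefs R n r) (S T : {set 'I_(r + r)})
  (f g : 'rV[R]_n -> coefs R n r).

(** Each pair (s, t) in S x T is an inversion of exactly one of the two
    concatenations, as s and t differ. *)
Lemma ksignC S T : [disjoint S & T] ->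
  ksign R S T = (-1) ^+ (#|S| * #|T|) * ksign R T S.
Proof.
move=> dST; rewrite /ksign -cardsX.
set A := [set _ | _]; set B := [set _ | _].
suff -> : #|finset.setX S T| = (#|A| + #|B|)%N.
  by rewrite exprD -mulrA -exprD (addnn #|B|) -[_ ^+ _.*2]signr_odd odd_double mulr1.
pose B' := [set st : 'I_(r + r) * 'I_(r + r) | (st.2, st.1) \in B].
have -> : #|B| = #|B'|.
  (* Swapping the entries turns the inversions of T, S into the pairs s < t. *)
  have sw : injective (fun st : 'I_(r + r) * 'I_(r + r) => (st.2, st.1)).
    by move=> [a b] [c d] [-> ->].
  rewrite -[LHS](card_imset _ sw); apply: eq_card => -[s t].
  rewrite [RHS]inE; apply/imsetP/idP => [[[a b] abB [-> ->]]|tsB] //.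
  by exists (t, s).
rewrite -cardsUI; have -> : #|A :&: B'| = 0%N.
  apply/eqP; rewrite cards_eq0 -finset.subset0; apply/fintype.subsetP => -[s t].
  rewrite !inE /= => /andP[/and3P[_ _ ts] /and3P[_ _ st]].
  by have := ltn_trans ts st; rewrite ltnn.
rewrite addn0; apply: eq_card => -[s t]; rewrite !inE /=.
have [sS|sS] := boolP (s \in S); have [tT|tT] := boolP (t \in T) => //=.
rewrite -neq_ltn eq_sym; apply/esym/eqP => st.
by move/(disjointFr dST): sS; rewrite (ord_inj st) tT.
Qed.

(** Graded commutativity in a form that allows the factors to change when
    they are exchanged: u' and v' absorb the sign that the exchange of u and v
    produces.  This is what is needed when right derivatives become left
    derivatives. *)
Lemma cmul_swap u v u' v' :
  (forall m m' T T', [disjoint T & T'] ->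
     (-1) ^+ (#|T| * #|T'|) * (u m T * v m' T') = v' m' T' * u' m T) ->
  cmul u v = cmul v' u'.
Proof.
move=> uv; apply/funext => m; apply/funext => S; rewrite /cmul.
pose rv (k : {dffun forall i : 'I_n, 'I_(m i).+1}) :
  {dffun forall i : 'I_n, 'I_(m i).+1} := [ffun i => rev_ord (k i)].
have rvK : involutive rv by move=> k; apply/ffunP => i; rewrite !ffunE rev_ordK.
(* Exchange the factors: the exponent k becomes m - k, and T its complement. *)
rewrite (reindex_inj (inv_inj rvK)); apply: eq_bigr => k _.
rewrite (reindex_onto (fun T => S :\: T) (fun T => S :\: T)); last first.
  by move=> T; rewrite powersetE => /finset.setIidPr TS;
    rewrite finset.setDDr finset.setDv finset.set0U.
apply: eq_big => [T|T].
  rewrite !powersetE finset.subDset finset.subsetUr /= finset.setDDr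
    finset.setDv finset.set0U.
  exact/eqP/finset.setIidPr.
move=> /andP[_ /eqP ->].
have -> : [ffun i => rv k i : nat] = [ffun i => (m i - k i)%N] :> mindex n.
  by apply/ffunP => i; rewrite !ffunE /= subSS.
have -> : [ffun i => (m i - rv k i)%N] = [ffun i => k i : nat] :> mindex n.
  apply/ffunP => i; rewrite !ffunE /= subSS subKn //.
  by rewrite -ltnS.
have dT : [disjoint S :\: T & T].
  by rewrite finset.disjoints_subset; apply/fintype.subsetP => a; rewrite !inE => /andP[].
by rewrite ksignC // -!mulrA -uv // !mulrA [_ * ksign _ _ _]mulrC.
Qed.

Lemma rderivE s u m S : rderiv s u m S = (-1) ^+ #|S| * lderiv s u m S.
Proof.
rewrite /rderiv /lderiv; case: ifPn => [_|sS]; first by rewrite mulr0.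
by rewrite ksignC ?cards1 ?muln1 ?mulrA // disjoint_sym disjoints1.
Qed.

(** The total degree counts p twice and xi, theta once, so it determines the
    parity of the number of odd generators. *)
Lemma card_bideg m S :
  (#|S| + (mdeg m).*2)%N = (bideg1 m S + bideg2 (n := n) m S)%N.
Proof.
rewrite /bideg1 /bideg2 addnACA (addnn (mdeg m)) [RHS]addnC; congr (_ + _)%N.
rewrite -!sum1_card big_mkcond big_split_ord /= addnC.
by congr (_ + _)%N; rewrite [RHS]big_mkcond; apply: eq_bigr => a _; rewrite inE.
Qed.

Lemma cbideg_in0 u : cbideg_in (fun _ _ => False) u -> u = 0.
Proof.
move=> u0; apply/funext => m; apply/funext => S.
by have [//|/u0] := eqVneq (u m S) 0.
Qed.

Lemma sub_cbideg (P Q : nat -> nat -> Prop) u :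
  (forall k l, P k l -> Q k l) -> cbideg_in P u -> cbideg_in Q u.
Proof. by move=> PQ uP m S /uP/PQ. Qed.

Lemma cmul0r u : cmul u 0 = 0.
Proof.
apply/funext => m; apply/funext => S.
by rewrite /cmul big1 // => k _; rewrite big1 // => T _; exact: mulr0.
Qed.

Lemma cmul0l u : cmul 0 u = 0.
Proof.
apply/funext => m; apply/funext => S; rewrite /cmul big1 // => k _.
by rewrite big1 // => T _; rewrite [X in X * _]mulr0 mul0r.
Qed.

Lemma cmul_linearl a u u' v : cmul (a *: u + u') v = a *: cmul u v + cmul u' v.
Proof.
apply/funext => m; apply/funext => S; rewrite /cmul.
rewrite -[RHS]/(a * _ + _) mulr_sumr -big_split; apply: eq_bigr => k _ /=.
rewrite mulr_sumr -big_split; apply: eq_bigr => T _ /=.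
by rewrite -[(_ *: _ + _) _ _]/(a * _ + _) mulrDr mulrDl !mulrA [_ * a]mulrC.
Qed.

Lemma cmulNl u v : cmul (- u) v = - cmul u v.
Proof.
by have := cmul_linearl (-1) u 0 v; rewrite cmul0l !addr0 !scaleN1r.
Qed.

Lemma deriv_p_linear i a u u' :
  deriv_p i (a *: u + u') = a *: deriv_p i u + deriv_p i u'.
Proof.
apply/funext => m; apply/funext => S.
by rewrite /deriv_p -[RHS]/(a * _ + _) -[(_ *: _ + _) _ _]/(a * _ + _) mulrnDl mulrnAr.
Qed.

Lemma rderiv_linear s a u u' :
  rderiv s (a *: u + u') = a *: rderiv s u + rderiv s u'.
Proof.
apply/funext => m; apply/funext => S; rewrite -[RHS]/(a * _ + _) /rderiv.
case: ifP => _; first by rewrite mulr0 addr0.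
by rewrite -[(_ *: _ + _) _ _]/(a * _ + _) mulrDr mulrCA.
Qed.

Lemma deriv_x_linear i a f f' x :
  (forall m S, differentiable (fun y => f y m S) x) ->
  (forall m S, differentiable (fun y => f' y m S) x) ->
  deriv_x i (a *: f + f') x = a *: deriv_x i f x + deriv_x i f' x.
Proof.
move=> df df'; apply/funext => m; apply/funext => S.
rewrite -[RHS]/(a *: _ + _) /deriv_x /partial.
pose h := (fun y => f y m S); pose h' := (fun y => f' y m S).
rewrite -[LHS]/('D_(delta_mx 0 i) (a *: h + h') x).
have dh : derivable h x (delta_mx 0 i) by apply: diff_derivable; exact: df.
have dh' : derivable h' x (delta_mx 0 i) by apply: diff_derivable; exact: df'.
by rewrite deriveD ?deriveZ //; exact: derivableZ.
Qed.

Lemma cbracket_linearl a f f' g x :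
  (forall m S, differentiable (fun y => f y m S) x) ->
  (forall m S, differentiable (fun y => f' y m S) x) ->
  cbracket (a *: f + f') g x = a *: cbracket f g x + cbracket f' g x.
Proof.
move=> df df'; rewrite /cbracket scalerDr addrACA; congr (_ + _).
  rewrite scaler_sumr -big_split; apply: eq_bigr => i _ /=.
  rewrite -[(_ *: _ + _) x]/(a *: f x + f' x) deriv_p_linear deriv_x_linear //.
  by rewrite !cmul_linearl opprD addrACA scalerBr.
rewrite scaler_sumr -big_split; apply: eq_bigr => s _ /=.
rewrite -[(_ *: _ + _) x]/(a *: f x + f' x) !rderiv_linear !cmul_linearl.
by rewrite addrACA scalerDr.
Qed.

(** For f of bidegree (2,0) only the x- and theta-derivatives survive.  The
    former are even and commute with everything.  The latter have degree one:
    exchanging them with a xi-derivative of g produces the sign that turns it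
    into a right derivative, while passing from the right to the left
    theta-derivative of f gives the global minus sign. *)
Lemma cbracket_antisym f g x :
  (forall y, cbideg_in (fun k l => k = 2 /\ l = 0%N) (f y)) ->
  cbracket f g x = - cbracket g f x.
Proof.
move=> hf; have hx := hf x; rewrite /cbracket opprD; congr (_ + _).
  rewrite -sumrN; apply: eq_bigr => i _; rewrite opprB.
  have -> : deriv_p i (f x) = 0.
    by apply/cbideg_in0/(sub_cbideg _ (deriv_p_bideg (i := i) hx)) => k l [].
  rewrite cmul0l cmul0r !sub0r; congr (- _).
  apply: cmul_swap => m m' T T' _.
  have [->|/(deriv_x_bideg hf)[e1 e2]] := eqVneq (deriv_x i f x m T) 0.
    by rewrite mul0r !mulr0.
  have Te : ~~ odd #|T|.
    by have := congr1 odd (card_bideg m T); rewrite e1 e2 oddD odd_double addbF => ->.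
  by rewrite -signr_odd oddM (negPf Te) /= mul1r mulrC.
rewrite -sumrN; apply: eq_bigr => a _; rewrite opprD.
have -> : rderiv (xi_ix a) (f x) = 0.
  by apply/cbideg_in0/(sub_cbideg _ (rderiv_xi_bideg (a := a) hx)) => k l [].
have -> : lderiv (xi_ix a) (f x) = 0.
  by apply/cbideg_in0/(sub_cbideg _ (lderiv_xi_bideg (a := a) hx)) => k l [].
rewrite cmul0l cmul0r oppr0 add0r addr0 -cmulNl.
apply: cmul_swap => m m' T T' _; rewrite -[(- _) _ _]/(- _) !rderivE.
have [->|/(lderiv_th_bideg hx)[[e1] e2]] := eqVneq (lderiv (th_ix a) (f x) m T) 0.
  by rewrite !(mulr0, mul0r).
have To : odd #|T|.
  by have := congr1 odd (card_bideg m T); rewrite e1 e2 oddD odd_double addbF => ->.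
rewrite -[(-1) ^+ #|T|]signr_odd -signr_odd oddM To /= signr_odd expr1.
by rewrite !mulNr !mul1r !mulrN -!mulrA; congr (- (_ * _)); rewrite mulrC.
Qed.

Section smooth_coefficients.
Variable W : set 'rV[R]_n.
Hypothesis oW : open W.

Definition smooth_coefs f : Prop := forall m S, smooth_on W (fun x => f x m S).

Lemma smooth_coefsD f g : smooth_coefs f -> smooth_coefs g -> smooth_coefs (f + g).
Proof. by move=> sf sg m S; exact: (smoothD oW (sf m S) (sg m S)). Qed.

Lemma smooth_coefsZ a f : smooth_coefs f -> smooth_coefs (a *: f).
Proof. by move=> sf m S; exact: (smoothM oW (smooth_cst oW a) (sf m S)). Qed.

Lemma smooth_cmul f g : smooth_coefs f -> smooth_coefs g ->
  smooth_coefs (fun x => cmul (f x) (g x)).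
Proof.
move=> sf sg m S; apply: smooth_sum => // k _; apply: smooth_sum => // T _.
apply: (smoothM oW _ (sg _ _)).
exact: (smoothM oW (smooth_cst oW _) (sf _ _)).
Qed.

Lemma smooth_deriv_p i f : smooth_coefs f -> smooth_coefs (fun x => deriv_p i (f x)).
Proof.
move=> sf m S; rewrite (_ : (fun x => _) =
  (fun x => f x [ffun j => (m j + (j == i))%N] S) * cst (m i).+1%:R).
  exact: (smoothM oW (sf _ _) (smooth_cst oW _)).
by apply/funext => x; rewrite /deriv_p -[LHS]mulr_natr.
Qed.

Lemma smooth_lderiv s f : smooth_coefs f -> smooth_coefs (fun x => lderiv s (f x)).
Proof.
move=> sf m S; rewrite /lderiv; case: (s \in S); first exact: smooth_cst.
exact: (smoothM oW (smooth_cst oW _) (sf _ _)).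
Qed.

Lemma smooth_rderiv s f : smooth_coefs f -> smooth_coefs (fun x => rderiv s (f x)).
Proof.
move=> sf m S; rewrite /rderiv; case: (s \in S); first exact: smooth_cst.
exact: (smoothM oW (smooth_cst oW _) (sf _ _)).
Qed.

Lemma smooth_deriv_x i f : smooth_coefs f -> smooth_coefs (deriv_x i f).
Proof. by move=> sf m S; exact: (smooth_partial i (sf m S)). Qed.

Lemma smooth_coefs_sum (I : Type) (s : seq I) (F : I -> 'rV[R]_n -> coefs R n r) :
  (forall i, smooth_coefs (F i)) -> smooth_coefs (fun x => \sum_(i <- s) F i x).
Proof.
move=> sF m S; rewrite (_ : (fun x => _) = (fun x => \sum_(i <- s) F i x m S)).
  by apply: smooth_sum => // i _; exact: sF.
by apply/funext => x; rewrite !fct_sumE.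
Qed.

Lemma smooth_cbracket f g : smooth_coefs f -> smooth_coefs g ->
  smooth_coefs (cbracket f g).
Proof.
move=> sf sg; apply: smooth_coefsD; apply: smooth_coefs_sum => i.
  rewrite (_ : (fun x => _) =
    (fun x => cmul (deriv_p i (f x)) (deriv_x i g x)) +
    (-1) *: (fun x => cmul (deriv_x i f x) (deriv_p i (g x)))); last first.
    by apply/funext => x; rewrite -scaleN1r.
  apply: smooth_coefsD; last apply: smooth_coefsZ; apply: smooth_cmul.
  - exact: smooth_deriv_p.
  - exact: smooth_deriv_x.
  - exact: smooth_deriv_x.
  - exact: smooth_deriv_p.
apply: smooth_coefsD; apply: smooth_cmul.
- exact: smooth_rderiv.
- exact: smooth_lderiv.
- exact: smooth_rderiv.
- exact: smooth_lderiv.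
Qed.

End smooth_coefficients.
End coordinate_bracket.

(** * The big bracket on families *)

Section families.
Variables (R : realType) (n r : nat) (M : manifold R n) (A : vbundle r M).
Implicit Types (F G : family A) (c : csys A).

(** The patch is the part of the open set coord (cdom) that the continuous map
    uncoord sends into tdom. *)
Lemma cpatch_open c : open (cpatch c).
Proof.
have oU := @coord_open _ _ M c.1; set U := (_ @` _)%classic in oU.
have := @uncoord_continuous _ _ M c.1.
rewrite continuous_open_subspace // => /(continuous_inP _ oU).
move=> /(_ _ (@tdom_open _ _ _ _ A c.2)); congr open; apply/seteqP; split=> x.
  move=> [[z cz <-]]; rewrite /preimage /= coordK // => tz.
  by exists z.
move=> [z [cz tz] <-]; split; first by exists z.
by rewrite /preimage /= coordK.
Qed.

Arguments cpatch_open : clear implicits.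

(** The part of being a function that linearity of the bracket relies on and
    that makes sense in each coordinate system separately, without glueing. *)
Definition smooth_family F : Prop := forall c, smooth_coefs (cpatch c) (F c).

Lemma is_function_smooth F : is_function F -> smooth_family F.
Proof. by case=> sF _ _ c m S; exact: sF. Qed.

Lemma smooth_family_bracket F G :
  smooth_family F -> smooth_family G -> smooth_family (bracket F G).
Proof.
move=> sF sG c m S.
have oc := cpatch_open c.
apply: (eq_smooth oc (f := fun x => cbracket (F c) (G c) x m S)).
  by move=> x xc; rewrite /bracket xc.
exact: (smooth_cbracket oc (sF c) (sG c)).
Qed.

Lemma smooth_familyD F G : smooth_family F -> smooth_family G -> smooth_family (F + G).
Proof. by move=> sF sG c; exact: (smooth_coefsD (cpatch_open c) (sF c) (sG c)). Qed.

Lemma smooth_familyZ a F : smooth_family F -> smooth_family (a *: F).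
Proof. by move=> sF c; exact: (smooth_coefsZ (cpatch_open c) a (sF c)). Qed.

Lemma smooth_familyN F : smooth_family F -> smooth_family (- F).
Proof. by move=> sF; rewrite -scaleN1r; exact: smooth_familyZ. Qed.

Lemma smooth_family0 : smooth_family 0.
Proof. by move=> c m S; exact: (smooth_cst (cpatch_open c)). Qed.

Lemma smooth_component k l F : smooth_family F -> smooth_family (component k l F).
Proof.
move=> sF c m S; rewrite /component; case: (_ && _); first exact: sF.
exact: (smooth_cst (cpatch_open c)).
Qed.

Lemma bracket_linearl a F F' G : smooth_family F -> smooth_family F' ->
  bracket (a *: F + F') G = a *: bracket F G + bracket F' G.
Proof.
move=> sF sF'; apply/funext => c; apply/funext => x.
rewrite -[RHS]/(a *: _ + _) /bracket; case: ifP => [/set_mem xc|_].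
  rewrite -[(_ *: _ + _) c]/(a *: F c + F' c) cbracket_linearl // => m S.
    exact: (sF c m S [::] x xc).
  exact: (sF' c m S [::] x xc).
by rewrite scaler0 addr0.
Qed.

Lemma bracket0l G : bracket 0 G = 0 :> family A.
Proof.
have := bracket_linearl (-1) G smooth_family0 smooth_family0.
by rewrite scaler0 addr0 scaleN1r addNr.
Qed.

Lemma bracketZl a F G : smooth_family F -> bracket (a *: F) G = a *: bracket F G.
Proof.
move=> sF; have := bracket_linearl a G sF smooth_family0.
by rewrite bracket0l !addr0.
Qed.

Lemma bracketDl F F' G : smooth_family F -> smooth_family F' ->
  bracket (F + F') G = bracket F G + bracket F' G.
Proof. by move=> sF sF'; have := bracket_linearl 1 G sF sF'; rewrite !scale1r. Qed.

Lemma bracketNl F G : smooth_family F -> bracket (- F) G = - bracket F G.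
Proof. by move=> sF; rewrite -scaleN1r bracketZl // scaleN1r. Qed.

Lemma bracketBl F F' G : smooth_family F -> smooth_family F' ->
  bracket (F - F') G = bracket F G - bracket F' G.
Proof.
move=> sF sF'; rewrite bracketDl ?bracketNl //.
exact: smooth_familyN.
Qed.

Lemma componentD k l F G : component k l (F + G) = component k l F + component k l G.
Proof.
apply/funext => c; apply/funext => x; apply/funext => m; apply/funext => S.
by rewrite -[RHS]/(_ + _) /component; case: ifP; rewrite ?addr0.
Qed.

Lemma componentZ k l a F : component k l (a *: F) = a *: component k l F.
Proof.
apply/funext => c; apply/funext => x; apply/funext => m; apply/funext => S.
by rewrite -[RHS]/(a * _) /component; case: ifP; rewrite ?mulr0.
Qed.

Lemma componentN k l F : component k l (- F) = - component k l F.
Proof. by rewrite -scaleN1r componentZ scaleN1r. Qed.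

Lemma component_id k l F :
  bideg_in (fun k' l' => k' = k /\ l' = l) F -> component k l F = F.
Proof.
move=> hF; apply/funext => c; apply/funext => x.
apply/funext => m; apply/funext => S; rewrite /component.
have [->|/hF[-> ->]] := eqVneq (F c x m S) 0; first by case: ifP.
by rewrite !eqxx.
Qed.

Lemma component_eq0 k l F :
  bideg_in (fun k' l' => ~ (k' = k /\ l' = l)) F -> component k l F = 0.
Proof.
move=> hF; apply/funext => c; apply/funext => x.
apply/funext => m; apply/funext => S; rewrite /component.
have [->|/hF nkl] := eqVneq (F c x m S) 0; first by case: ifP.
by case: ifP => // /andP[/eqP ek /eqP el]; case: nkl.
Qed.

Lemma component_bideg k l F :
  bideg_in (fun k' l' => k' = k /\ l' = l) (component k l F).
Proof.
move=> c x m S; rewrite /component.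
by case: ifP => [/andP[/eqP-> /eqP->]|]; rewrite ?eqxx.
Qed.

Section bivector.
Variable pi : family A.
Hypothesis hpi : bideg_in (fun k l => k = 2 /\ l = 0%N) pi.

Lemma bracket_antisym F : bracket pi F = - bracket F pi.
Proof.
apply/funext => c; apply/funext => x; rewrite -[RHS]/(- _) /bracket.
case: ifP => _; last by rewrite oppr0.
by apply: cbracket_antisym => y m S; exact: hpi.
Qed.

(** F splits into its (k, l+1) component and a remainder without that component;
    the bracket with pi sends the remainder outside bidegree (k+1, l). *)
Lemma component_bracket k l F : smooth_family F ->
  component k.+1 l (bracket F pi) = bracket (component k l.+1 F) pi.
Proof.
move=> sF; have sC := smooth_component k l.+1 sF.
have sN := smooth_familyN sC.
rewrite -{1}(subrK (component k l.+1 F) F) bracketDl //; last exact: smooth_familyD.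
rewrite componentD component_eq0 ?add0r.
  apply: component_id => c x m S.
  move=> /(bracket_bideg (component_bideg (F := F)) hpi).
  move=> [k1 [l1 [k2 [l2 [[-> ->] [-> ->]]]]]].
  by rewrite addn2 addn0 => -[->] [->].
have hN : bideg_in (fun k' l' => ~ (k' = k /\ l' = l.+1)) (F - component k l.+1 F).
  move=> c x m S; apply: contra_neqP => /contrapT[ek el].
  by rewrite -[LHS]/(_ - _) /component ek el !eqxx subrr.
move=> c x m S /(bracket_bideg hN hpi)[k1 [l1 [k2 [l2 [nkl [-> ->]]]]]].
move: nkl; rewrite addn2 addn0 => nkl [->] Ll [[ek] el]; apply: nkl.
by rewrite -Ll ek el.
Qed.

(** Every term of a bracket with pi has first degree at least one. *)
Lemma component0_bracket l F : component 0 l (bracket F pi) = 0.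
Proof.
apply: component_eq0 => c x m S.
have hF : bideg_in (fun _ _ => True) F by [].
move=> /(bracket_bideg hF hpi)[k1 [l1 [k2 [l2 [_ [-> _] + _]]]]].
by rewrite addn2 => -[->] [].
Qed.

Lemma twistE F : smooth_family F -> smooth_family pi ->
  twist pi F = F - bracket F pi + (2%:R : R)^-1 *: bracket (bracket F pi) pi
    - (6%:R : R)^-1 *: bracket (bracket (bracket F pi) pi) pi.
Proof.
move=> sF spi; rewrite /twist !big_ord_recr big_ord0 /= add0r.
have s1 := smooth_family_bracket sF spi.
have s2 := smooth_family_bracket s1 spi.
rewrite !bracket_antisym !bracketNl //; last exact: smooth_familyN.
by rewrite !opprK invr1 !scale1r !scalerN.
Qed.

End bivector.
End families.

(** * The twisted brackets *)

Theorem proposition6p6 (R : realType) (n r : nat) (M : manifold R n)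
    (A : vbundle r M) (Theta : family A) (hTheta : Ftot 3 Theta)
    (pi : polyvec A) (hpi : Fbi 2 0 pi) :
  brackets_of (twist pi Theta) = btwist pi (brackets_of Theta).
Proof.
have spv (P : polyvec A) : smooth_family P.
  exact: is_function_smooth (pv_function P).
have sT := is_function_smooth hTheta.1.
have s1 := smooth_family_bracket sT (spv pi).
have s2 := smooth_family_bracket s1 (spv pi).
have dpi := hpi.2.
have cpi := component_bracket dpi.
have c0 := component0_bracket dpi.
have compE k l : component k l (twist pi Theta) = component k l Theta
    - component k l (bracket Theta pi)
    + (2%:R : R)^-1 *: component k l (bracket (bracket Theta pi) pi)
    - (6%:R : R)^-1 *: component k l (bracket (bracket (bracket Theta pi) pi) pi).
  by rewrite twistE // !componentD !componentN !componentZ.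
have c03 : component 0 3 (twist pi Theta) = component 0 3 Theta.
  by rewrite compE !c0 !scaler0 !subr0 addr0.
have c12 : component 1 2 (twist pi Theta) =
    component 1 2 Theta - bracket (component 0 3 Theta) pi.
  by rewrite compE !cpi // !c0 !bracket0l !scaler0 subr0 addr0.
have c21 : component 2 1 (twist pi Theta) =
    component 2 1 Theta - bracket (component 1 2 Theta) pi
    + (2%:R : R)^-1 *: bracket (bracket (component 0 3 Theta) pi) pi.
  by rewrite compE !cpi // !c0 !bracket0l !scaler0 subr0.
have c30 : component 3 0 (twist pi Theta) =
    component 3 0 Theta - bracket (component 2 1 Theta) pi
    + (2%:R : R)^-1 *: bracket (bracket (component 1 2 Theta) pi) pi
    - (6%:R : R)^-1 *:
        bracket (bracket (bracket (component 0 3 Theta) pi) pi) pi.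
  by rewrite compE !cpi.
rewrite /brackets_of /btwist c30 c21 c12 c03 /=.
have sC k l := smooth_component k l sT.
have sB F (P : polyvec A) : smooth_family F -> smooth_family (bracket F P).
  by move=> sF; exact: smooth_family_bracket (spv P).
have sN F : smooth_family F -> smooth_family (- F) by exact: smooth_familyN.
congr Brackets; apply/funext => P.
  rewrite bracketDl; [|apply: smooth_familyD|apply: smooth_familyZ]; auto.
  by rewrite bracketBl ?bracketZl; auto.
by apply/funext => Q; rewrite !bracketBl; auto.
Qed.
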